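(* Each of the following linkage update rules $f(s_{12},s_{23},s_{13},n_1,n_2,n_3)$ satisfies both Condition A (monotonicity across merges) and Condition B (dominance preservation): (1) single linkage: $f=\max\{s_{23},s_{13}\}$; (2) complete linkage: $f=\min\{s_{23},s_{13}\}$; (3) weighted average linkage: $f=\frac{n_1}{n_1+n_2}s_{13}+\frac{n_2}{n_1+n_2}s_{23}$; (4) unweighted average linkage: $f=\frac{s_{13}+s_{23}}{2}$.
   Context: $\mathbb{R}_+=[0,\infty)$. A similarity function on a finite set $\mathcal{X}=\{x_1,\dots,x_k\}$ is a symmetric map $s:\mathcal{X}\times\mathcal{X}\to\mathbb{R}_+$ with $s(x,x)>s(x,y)$ for all $x\ne y$. Linkage algorithm on $(\mathcal{X},s,f)$: start with active clusters $\mathcal{C}^{(0)}=\{\{x_1\},\dots,\{x_k\}\}$ and $s(\{x\},\{y\})=s(x,y)$. For $m=1,\dots,k-1$: select distinct $t_1,t_2\in\mathcal{C}^{(m-1)}$ maximizing $s(t_1',t_2')$ over pairs of distinct elements of $\mathcal{C}^{(m-1)}$ (ties broken arbitrarily); set $\mathcal{C}^{(m)}=(\mathcal{C}^{(m-1)}\setminus\{t_1,t_2\})\cup\{t_1\cup t_2\}$; and for every other $t_3\in\mathcal{C}^{(m)}$ define $$s(t_1\cup t_2,t_3)=s(t_3,t_1\cup t_2)=f\big(s(t_1,t_2),s(t_2,t_3),s(t_3,t_1),|t_1|,|t_2|,|t_3|\big).$$ In the two conditions below, $s(\cdot,\cdot)$ between clusters denotes the extension of $s$ produced by a run of the linkage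 algorithm with rule $f$. Condition A: for every $(\mathcal{X},s)$, every run, every step, and all pairwise distinct active clusters $t_1,t_2,t_3,t_4$ (just before that step) such that $\{t_1,t_2\}$ is the pair selected for merging at that step: if $s(t_i,t_3)>\max(s(t_i,t_4),s(t_3,t_4))$ for $i=1,2$, then $s(t_1\cup t_2,t_3)>\max(s(t_1\cup t_2,t_4),s(t_3,t_4))$. Condition B: for every $(\mathcal{X},s)$, every run, every step, and all pairwise distinct active clusters $t_1,t_2,t_3,t_4$ (just before that step) such that $\{t_3,t_4\}$ is the pair selected for merging at that step: if $s(t_1,t_2)>\max_{i\in\{1,2\},j\in\{3,4\}}s(t_i,t_j)$, then $s(t_1,t_2)>\max_{i\in\{1,2\}}s(t_i,t_3\cup t_4)$. *)

(* Defs.v *)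
From mathcomp Require Import all_boot all_order all_algebra.
From mathcomp Require Import reals.

Set Implicit Arguments.
Unset Strict Implicit.
Unset Printing Implicit Defensive.

Import Order.TTheory GRing.Theory Num.Theory.
Local Open Scope ring_scope.

Definition similarity (R : realType) (X : finType) (s : X -> X -> R) : Prop :=
  [/\ forall x y, 0 <= s x y,
      forall x y, s x y = s y x
    & forall x y, x != y -> s x y < s x x].

(* Argument order: s_12, s_23, s_13, n_1, n_2, n_3. *)
Definition linkage_rule (R : realType) : Type :=
  R -> R -> R -> nat -> nat -> nat -> R.

(* [C m] is the set of active clusters after [m] merges, [a m] and [b m] are
   the clusters t_1 and t_2 merged to form [C m.+1], and [S] is the extension
   of [s] to clusters. A single [S] serves the whole run because a merged
   cluster is never equal to a cluster active earlier, so each value is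
   prescribed at most once; values of [S] at pairs that are never prescribed
   are unconstrained. *)
Record linkage_run (R : realType) (f : linkage_rule R) (X : finType)
    (s : X -> X -> R) (C : nat -> {set {set X}}) (a b : nat -> {set X})
    (S : {set X} -> {set X} -> R) : Prop := LinkageRun {
  run_init : C 0%N = [set [set x] | x : X];
  run_init_sim : forall x y, S [set x] [set y] = s x y;
  run_select : forall m, (m < #|X|.-1)%N ->
    [/\ a m \in C m, b m \in C m, a m != b m
      & forall t1' t2', t1' \in C m -> t2' \in C m -> t1' != t2' ->
          S t1' t2' <= S (a m) (b m)];
  run_merge : forall m, (m < #|X|.-1)%N ->
    C m.+1 = (a m :|: b m) |: (C m :\: [set a m; b m]);
  run_update : forall m t3, (m < #|X|.-1)%N ->
    t3 \in C m.+1 -> t3 != a m :|: b m ->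
    let v := f (S (a m) (b m)) (S (b m) t3) (S t3 (a m))
               #|a m| #|b m| #|t3| in
    S (a m :|: b m) t3 = v /\ S t3 (a m :|: b m) = v
}.

Definition condition_A (R : realType) (f : linkage_rule R) : Prop :=
  forall (X : finType) (s : X -> X -> R), similarity s ->
  forall C a b S, linkage_run f s C a b S ->
  forall m, (m < #|X|.-1)%N ->
  forall t1 t2 t3 t4 : {set X},
    t1 \in C m -> t2 \in C m -> t3 \in C m -> t4 \in C m ->
    uniq [:: t1; t2; t3; t4] ->
    [set t1; t2] = [set a m; b m] ->
    S t1 t3 > Num.max (S t1 t4) (S t3 t4) ->
    S t2 t3 > Num.max (S t2 t4) (S t3 t4) ->
    S (t1 :|: t2) t3 > Num.max (S (t1 :|: t2) t4) (S t3 t4).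

Definition condition_B (R : realType) (f : linkage_rule R) : Prop :=
  forall (X : finType) (s : X -> X -> R), similarity s ->
  forall C a b S, linkage_run f s C a b S ->
  forall m, (m < #|X|.-1)%N ->
  forall t1 t2 t3 t4 : {set X},
    t1 \in C m -> t2 \in C m -> t3 \in C m -> t4 \in C m ->
    uniq [:: t1; t2; t3; t4] ->
    [set t3; t4] = [set a m; b m] ->
    S t1 t2 > Num.max (Num.max (S t1 t3) (S t1 t4))
                      (Num.max (S t2 t3) (S t2 t4)) ->
    S t1 t2 > Num.max (S t1 (t3 :|: t4)) (S t2 (t3 :|: t4)).

Definition single_linkage (R : realType) : linkage_rule R :=
  fun s12 s23 s13 n1 n2 n3 => Num.max s23 s13.

Definition complete_linkage (R : realType) : linkage_rule R :=
  fun s12 s23 s13 n1 n2 n3 => Num.min s23 s13.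

Definition weighted_average_linkage (R : realType) : linkage_rule R :=
  fun s12 s23 s13 n1 n2 n3 =>
    n1%:R / (n1 + n2)%N%:R * s13 + n2%:R / (n1 + n2)%N%:R * s23.

Definition unweighted_average_linkage (R : realType) : linkage_rule R :=
  fun s12 s23 s13 n1 n2 n3 => (s13 + s23) / 2%:R.

(* Main.v *)
Require Import Defs.
From mathcomp Require Import all_boot all_order all_algebra.
From mathcomp Require Import reals.
From mathcomp Require Import lra.

(** Each of the four rules is a strict mean of s_13 and s_23: with the merged
    pair fixed it is strictly increasing under a simultaneous increase of both
    arguments, it does not depend on n_3, and it returns c at (c, c). Conditions
    A and B hold for any such rule, by comparing the arguments one by one, either
    with those of the other new similarity or with a constant. Active clusters
    stay nonempty and disjoint, so the new cluster differs from the other active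
    ones, and S stays symmetric on distinct active clusters. *)

Set Implicit Arguments.
Unset Strict Implicit.
Unset Printing Implicit Defensive.

Import Order.TTheory GRing.Theory Num.Theory.
Local Open Scope ring_scope.

(** Both arguments must grow, since the maximum and the minimum are not strictly increasing in each
    argument separately. The sizes [n3] and [n3'] may differ because Condition A compares the new
    cluster with two clusters of unrelated sizes. Positive [n1], [n2] keep the weights of the
    weighted average well defined and positive. *)
Definition strict_mean_rule (R : realType) (f : linkage_rule R) : Prop :=
  (forall s12 c n1 n2 n3, (0 < n1)%N -> (0 < n2)%N ->
     f s12 c c n1 n2 n3 = c) /\
  (forall s12 x y x' y' n1 n2 n3 n3', (0 < n1)%N -> (0 < n2)%N ->
     x < x' -> y < y' -> f s12 x y n1 n2 n3 < f s12 x' y' n1 n2 n3').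

Section Run.
Context (R : realType) (f : linkage_rule R) (X : finType) (s : X -> X -> R).
Context (C : nat -> {set {set X}}) (a b : nat -> {set X}).
Context (S : {set X} -> {set X} -> R).
Hypotheses (sim_s : similarity s) (runS : linkage_run f s C a b S).

Lemma active_neq0 m t : (m <= #|X|.-1)%N -> t \in C m -> t != set0.
Proof.
elim: m t => [|m IHm] t ltm.
  rewrite (run_init runS) => /imsetP[x _ ->].
  by apply/set0Pn; exists x; rewrite set11.
rewrite (run_merge runS ltm) => /setU1P[->|/setDP[tC _]]; last first.
  exact: IHm (ltnW ltm) tC.
have [aC _ _ _] := run_select runS ltm.
by rewrite setU_eq0 negb_and (IHm _ (ltnW ltm) aC).
Qed.

Lemma active_disjoint m t t' : (m <= #|X|.-1)%N ->
  t \in C m -> t' \in C m -> t != t' -> [disjoint t & t'].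
Proof.
elim: m t t' => [|m IHm] t t' ltm.
  rewrite (run_init runS) => /imsetP[x _ ->] /imsetP[y _ ->] neq.
  by rewrite disjoints1 inE; apply: contraNneq neq => ->.
have [aC bC _ _] := run_select runS ltm.
have disjU u : u \in C m :\: [set a m; b m] -> [disjoint a m :|: b m & u].
  case/setDP=> uC; rewrite !inE negb_or => /andP[ua ub].
  rewrite -setI_eq0 setIUl setU_eq0 !setI_eq0.
  by rewrite !IHm 1?eq_sym // ltnW.
rewrite (run_merge runS ltm) => /setU1P[->|tC] /setU1P[->|t'C].
- by rewrite eqxx.
- by rewrite disjU.
- by rewrite disjoint_sym disjU.
- have [{}tC _] := setDP tC; have [{}t'C _] := setDP t'C.
  exact: IHm (ltnW ltm) tC t'C.
Qed.

(** Symmetry starts with that of [s]. A merge gives both orders of a new pair the same value, and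
    every other pair was already active before it. *)
Lemma active_sym m t t' : (m <= #|X|.-1)%N ->
  t \in C m -> t' \in C m -> t != t' -> S t t' = S t' t.
Proof.
have [_ symS _] := sim_s.
elim: m t t' => [|m IHm] t t' ltm.
  rewrite (run_init runS) => /imsetP[x _ ->] /imsetP[y _ ->] _.
  by rewrite !(run_init_sim runS).
have symU u : u \in C m.+1 -> u != a m :|: b m ->
    S (a m :|: b m) u = S u (a m :|: b m).
  by move=> uC neq; have [-> ->] := run_update runS ltm uC neq.
have [->|neqt] := eqVneq t (a m :|: b m).
  by move=> _ t'C; rewrite eq_sym => /(symU _ t'C).
have [->|neqt'] := eqVneq t' (a m :|: b m).
  by move=> tC _ _; rewrite symU.
rewrite (run_merge runS ltm) !in_setU1 (negPf neqt) (negPf neqt') /=.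
move=> /setDP[tC _] /setDP[t'C _].
exact: IHm (ltnW ltm) tC t'C.
Qed.

Lemma update_active m t : (m < #|X|.-1)%N ->
  t \in C m -> t != a m -> t != b m ->
  let v := f (S (a m) (b m)) (S (b m) t) (S (a m) t) #|a m| #|b m| #|t| in
  S (a m :|: b m) t = v /\ S t (a m :|: b m) = v.
Proof.
move=> ltm tC ta tb.
have [aC _ _ _] := run_select runS ltm.
rewrite (@active_sym m (a m) t) // 1?eq_sym //; last exact: ltnW.
apply: (run_update runS) => //.
  by rewrite (run_merge runS ltm) !inE negb_or ta tb tC orbT.
(* If [t] were the merged cluster it would contain [a m]; being disjoint from [a m], it would force
   [a m] to be empty. *)
apply: contraNneq (active_neq0 (ltnW ltm) aC) => tab.
have := active_disjoint (ltnW ltm) tC aC ta.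
by rewrite -setI_eq0 tab setUK.
Qed.

Lemma card_merged_gt0 m : (m < #|X|.-1)%N -> (0 < #|a m|)%N /\ (0 < #|b m|)%N.
Proof.
move=> ltm; have [aC bC _ _] := run_select runS ltm.
by rewrite !card_gt0 !(@active_neq0 m) // ltnW.
Qed.

End Run.

(** The conditions give the merged pair as an unordered set, so its members match [a m] and [b m] in
    one of two orders. *)
Lemma eq_set2 (T : finType) (x y u v : T) :
  x != y -> [set x; y] = [set u; v] -> (x = u /\ y = v) \/ (x = v /\ y = u).
Proof.
move=> neq eqS; have := set21 x y; have := set22 x y.
rewrite eqS => /set2P[] yE /set2P[] xE; move: neq;
  rewrite xE yE ?eqxx //; [right|left] => //.
Qed.

Lemma strict_mean_condition_A (R : realType) (f : linkage_rule R) :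
  strict_mean_rule f -> condition_A f.
Proof.
move=> [f_id f_lt] X s sim_s C a b S runS m ltm t1 t2 t3 t4 t1C t2C t3C t4C.
move=> uniq_t eq_ab.
have [a0 b0] := card_merged_gt0 runS ltm.
have main : a m != t3 -> b m != t3 -> a m != t4 -> b m != t4 ->
    S (a m) t3 > Num.max (S (a m) t4) (S t3 t4) ->
    S (b m) t3 > Num.max (S (b m) t4) (S t3 t4) ->
    S (a m :|: b m) t3 > Num.max (S (a m :|: b m) t4) (S t3 t4).
  rewrite !gt_max ![a m == _]eq_sym ![b m == _]eq_sym.
  move=> a3 b3 a4 b4 /andP[lta lta'] /andP[ltb ltb'].
  have [-> _] := update_active sim_s runS ltm t3C a3 b3.
  have [-> _] := update_active sim_s runS ltm t4C a4 b4.
  (* The similarities to [t3] exceed those to [t4] argument by argument. *)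
  rewrite f_lt //=.
  (* The bound [S t3 t4] is rewritten as the rule at two equal arguments, so that monotonicity
     applies again; the third size 0 is a dummy. *)
  rewrite -[ltLHS](f_id (S (a m) (b m)) (S t3 t4) #|a m| #|b m| 0%N) //.
  exact: f_lt.
move: uniq_t; rewrite /= !inE !negb_or.
move=> /and4P[/and3P[t12 t13 t14] /andP[t23 t24] _ _].
case: (eq_set2 t12 eq_ab) => -[eq1 eq2]; subst t1 t2; first exact: main.
by rewrite setUC => lt1 lt2; apply: main.
Qed.

Lemma strict_mean_condition_B (R : realType) (f : linkage_rule R) :
  strict_mean_rule f -> condition_B f.
Proof.
move=> [f_id f_lt] X s sim_s C a b S runS m ltm t1 t2 t3 t4 t1C t2C t3C t4C.
move=> uniq_t eq_ab.
have [a0 b0] := card_merged_gt0 runS ltm.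
have [aC bC _ _] := run_select runS ltm.
(* It suffices to bound each outside cluster separately; [c] will be [S t1 t2], and the order of the
   merged pair is immaterial. *)
have main t c : t \in C m -> t != a m -> t != b m ->
    S t (a m) < c -> S t (b m) < c -> S t (a m :|: b m) < c.
  move=> tC ta tb lta ltb.
  have [_ ->] := update_active sim_s runS ltm tC ta tb.
  rewrite -[ltRHS](f_id (S (a m) (b m)) c #|a m| #|b m| 0%N) //.
  have symS := active_sym sim_s runS (ltnW ltm).
  by rewrite f_lt // symS // eq_sym.
move: uniq_t; rewrite /= !inE !negb_or.
move=> /and4P[/and3P[t12 t13 t14] /andP[t23 t24] t34 _].
rewrite !gt_max => /andP[/andP[lt13 lt14] /andP[lt23 lt24]].
case: (eq_set2 t34 eq_ab) => -[eq3 eq4]; subst t3 t4; last rewrite setUC.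
  by rewrite !main.
by rewrite !main.
Qed.

(** Each old argument lies below its own replacement, hence below the larger of the two. *)
Lemma single_linkage_strict_mean (R : realType) :
  strict_mean_rule (@single_linkage R).
Proof.
split=> [s12 c n1 n2 n3 _ _|s12 x y x' y' n1 n2 n3 n3' _ _ ltx lty].
  exact: maxxx.
by rewrite /single_linkage gt_max !lt_max ltx lty orbT.
Qed.

Lemma complete_linkage_strict_mean (R : realType) :
  strict_mean_rule (@complete_linkage R).
Proof.
split=> [s12 c n1 n2 n3 _ _|s12 x y x' y' n1 n2 n3 n3' _ _ ltx lty].
  exact: minxx.
by rewrite /complete_linkage lt_min !gt_min ltx lty orbT.
Qed.

(** The rule is a convex combination with positive weights. *)
Lemma weighted_average_linkage_strict_mean (R : realType) :
  strict_mean_rule (@weighted_average_linkage R).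
Proof.
rewrite /weighted_average_linkage.
split=> [s12 c n1 n2 n3 n1_gt0 _
      |s12 x y x' y' n1 n2 n3 n3' n1_gt0 n2_gt0 ltx lty].
  rewrite -mulrDl -mulrDl -natrD divff ?mul1r //.
  by rewrite pnatr_eq0 -lt0n addn_gt0 n1_gt0.
by rewrite ltrD // ltr_pM2l // divr_gt0 ?ltr0n // addn_gt0 n1_gt0.
Qed.

Lemma unweighted_average_linkage_strict_mean (R : realType) :
  strict_mean_rule (@unweighted_average_linkage R).
Proof.
rewrite /unweighted_average_linkage.
by split=> [s12 c n1 n2 n3 _ _|s12 x y x' y' n1 n2 n3 n3' _ _ ltx lty]; lra.
Qed.

Theorem lemma4 (R : realType) :
  [/\ condition_A (@single_linkage R) /\ condition_B (@single_linkage R),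
      condition_A (@complete_linkage R) /\ condition_B (@complete_linkage R),
      condition_A (@weighted_average_linkage R) /\
      condition_B (@weighted_average_linkage R)
    & condition_A (@unweighted_average_linkage R) /\
      condition_B (@unweighted_average_linkage R)].
Proof.
have AB f : strict_mean_rule f -> @condition_A R f /\ condition_B f.
  by move=> mean_f; split;
    [exact: strict_mean_condition_A | exact: strict_mean_condition_B].
split; apply: AB.
- exact: single_linkage_strict_mean.
- exact: complete_linkage_strict_mean.
- exact: weighted_average_linkage_strict_mean.
- exact: unweighted_average_linkage_strict_mean.
Qed.
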